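(* For all $k,l\in\mathbb{N}$, the rings $(\Omega_k,+,* )$ and $(\Omega_l,+,* )$ are isomorphic.
   Context: $\Omega_k$ is the set of all functions $\mathbb{N}^k\to\mathbb{C}$ with pointwise addition and the multiple Dirichlet product $(f*g)(\mathbf{n})=\sum_{\mathbf{a}\cdot\mathbf{b}=\mathbf{n}} f(\mathbf{a})g(\mathbf{b})$, where $\mathbf{a}\cdot\mathbf{b}=(a_1b_1,\ldots,a_kb_k)$. *)

(* Defs.v *)
From HB Require Import structures.
From mathcomp Require Import all_boot all_order all_algebra.
From mathcomp Require Import finmap.
From mathcomp Require Import mathcomp_extra boolp classical_sets functions.
From mathcomp Require Import cardinality fsbigop reals.
From mathcomp Require Import complex.

Set Implicit Arguments.
Unset Strict Implicit.
Unset Printing Implicit Defensive.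

Import GRing.Theory.
Local Open Scope classical_set_scope.
Local Open Scope ring_scope.

Definition pnat := {n : nat | (0 < n)%N}.

Definition pnat1 : pnat := exist (fun n => (0 < n)%N) 1%N isT.

Lemma pnat_mul_gt0 (m n : pnat) : (0 < val m * val n)%N.
Proof. by rewrite muln_gt0 (valP m) (valP n). Qed.

Definition pnat_mul (m n : pnat) : pnat :=
  exist (fun n => (0 < n)%N) (val m * val n)%N (pnat_mul_gt0 m n).

Definition pvec (k : nat) := {ffun 'I_k -> pnat}.

Definition pvec1 k : pvec k := [ffun=> pnat1].

Definition pvec_mul k (a b : pvec k) : pvec k :=
  [ffun i => pnat_mul (a i) (b i)].

Lemma pvec_mulA k : associative (@pvec_mul k).
Proof.
by move=> a b c; apply/ffunP => i; rewrite !ffunE; apply/val_inj/mulnA.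
Qed.

Lemma pvec_mulC k : commutative (@pvec_mul k).
Proof.
by move=> a b; apply/ffunP => i; rewrite !ffunE; apply/val_inj/mulnC.
Qed.

Lemma pvec_mul1 k : left_id (pvec1 k) (@pvec_mul k).
Proof.
by move=> a; apply/ffunP => i; rewrite !ffunE; apply/val_inj/mul1n.
Qed.

Lemma finite_pvec_divisors k (n : pvec k) :
  finite_set [set a | exists b, pvec_mul a b = n].
Proof.
pose N := (\max_(i < k) val (n i))%N.
pose h (g : {ffun 'I_k -> 'I_N}) : pvec k :=
  [ffun i => exist (fun n => (0 < n)%N) (g i).+1 (ltn0Sn _)].
apply: (@sub_finite_set _ _ (h @` [set: _])); last first.
  exact/finite_image/finite_finset.
move=> a [b abn].
have aN i : ((val (a i)).-1 < N)%N.
  rewrite prednK ?(valP (a i))//; apply: leq_trans (leq_bigmax i).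
  by rewrite -abn ffunE /= leq_pmulr// (valP (b i)).
exists [ffun i => Ordinal (aN i)] => //; apply/ffunP => i; rewrite !ffunE.
by apply: val_inj; rewrite /= prednK// (valP (a i)).
Qed.

Definition Omega (R : realType) (k : nat) := pvec k -> R[i].

(* Only the additive structure of functions is inherited: the library's product
   on pvec k -> R[i] is pointwise, whereas the one of Omega is Dirichlet's. *)
HB.instance Definition _ (R : realType) (k : nat) :=
  GRing.Zmodule.copy (Omega R k) (pvec k -> R[i]).

Section Dirichlet.
Variables (R : realType) (k : nat).
Implicit Types (f g h : Omega R k) (a b c n : pvec k).

(* Both components of an index divide n, so the index set is finite by
   finite_pvec_divisors and this is the true sum, not the default value
   that \sum_(_ \in _) takes on infinite supports. *)
Definition dirichlet_mul f g : Omega R k :=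
  fun n => \sum_(ab \in [set ab | pvec_mul ab.1 ab.2 = n]) f ab.1 * g ab.2.

Definition dirichlet_one : Omega R k := fun n => (n == pvec1 k)%:R.

Definition covers n (s : seq (pvec k)) :=
  uniq s /\ forall a b, pvec_mul a b = n -> a \in s.

Lemma covers_ex n : exists s, covers n s.
Proof.
exists (fset_set [set a | exists b, pvec_mul a b = n]); split=> [|a b abn].
  exact: fset_uniq.
rewrite in_fset_set; last exact: finite_pvec_divisors.
by rewrite inE; exists b.
Qed.

Lemma covers_dvd n s c d : covers n s -> pvec_mul c d = n -> covers c s.
Proof.
move=> [us sn] cdn; split=> // a b abc.
by apply: (sn a (pvec_mul b d)); rewrite pvec_mulA abc.
Qed.

Lemma dirichlet_mulE n s f g : covers n s ->
  dirichlet_mul f g n =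
  \sum_(a <- s) \sum_(b <- s | pvec_mul a b == n) f a * g b.
Proof.
move=> [us sn]; under eq_bigr do rewrite big_mkcond.
rewrite -(big_allpairs (F := fun ab => if pvec_mul ab.1 ab.2 == n
                                  then f ab.1 * g ab.2 else 0)) -big_mkcond.
rewrite bigfs; last first.
- move=> [a b] /eqP abn /negP[]; apply/allpairsP; exists (a, b).
  by split=> //=; [exact: sn abn | apply: (sn b a); rewrite pvec_mulC].
- by apply: allpairs_uniq => // -[? ?] [? ?].
by apply: eq_fsbigl; apply/seteqP; split=> ab /eqP.
Qed.

Lemma dirichlet_mulC : commutative dirichlet_mul.
Proof.
move=> f g; apply/funext => n; have [s ns] := covers_ex n.
rewrite !(dirichlet_mulE _ _ ns) (exchange_big_dep xpredT) //=.
apply: eq_bigr => a _; apply: eq_big => [b|b _]; last by rewrite mulrC.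
by rewrite pvec_mulC.
Qed.

Lemma dirichlet_mul3E n s f g h : covers n s ->
  dirichlet_mul f (dirichlet_mul g h) n =
  \sum_(a <- s) \sum_(b <- s) \sum_(c <- s | pvec_mul a (pvec_mul b c) == n)
    f a * (g b * h c).
Proof.
move=> ns; rewrite (dirichlet_mulE _ _ ns); apply: eq_bigr => a _.
have nse e : pvec_mul a e == n -> covers e s.
  by move/eqP; rewrite pvec_mulC; exact: covers_dvd.
under eq_bigr => e aen do
  rewrite (dirichlet_mulE _ _ (nse _ aen)) mulr_sumr.
rewrite (exchange_big_dep xpredT) //=; apply: eq_bigr => b _.
under eq_bigr do rewrite mulr_sumr.
rewrite (exchange_big_dep (fun c => pvec_mul a (pvec_mul b c) == n)) /=;
  last by move=> e c; rewrite andbT => aen /eqP ->.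
apply: eq_bigr => c abcn.
under eq_bigl => e.
  have -> : (pvec_mul a e == n) && true && (pvec_mul b c == e) = (e == pvec_mul b c).
    rewrite [RHS]eq_sym; case: (eqVneq (pvec_mul b c) e) => [<-|].
      by rewrite abcn.
    by rewrite andbF.
  over.
case: ns => us sn; rewrite -big_filter filter_pred1_uniq ?big_seq1 //.
apply: (sn (pvec_mul b c) a).
by rewrite pvec_mulC; exact/eqP.
Qed.

Lemma dirichlet_mulA : associative dirichlet_mul.
Proof.
move=> f g h; apply/funext => n; have [s ns] := covers_ex n.
rewrite [RHS](_ : _ = dirichlet_mul h (dirichlet_mul f g) n); last first.
  by rewrite dirichlet_mulC.
rewrite !(dirichlet_mul3E _ _ _ ns) [RHS]exchange_big /=.
apply: eq_bigr => a _.
under [LHS]eq_bigr do rewrite big_mkcond.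
under [RHS]eq_bigr do rewrite big_mkcond.
rewrite exchange_big /=; apply: eq_bigr => c _; apply: eq_bigr => b _.
by rewrite pvec_mulA [pvec_mul (pvec_mul a b) c]pvec_mulC mulrA mulrC.
Qed.

Lemma dirichlet_mul1 : left_id dirichlet_one dirichlet_mul.
Proof.
move=> f; apply/funext => n; rewrite /dirichlet_mul.
rewrite -(fsbig_widen [set (pvec1 k, n)]) /=.
- by rewrite fsbig_set1 /= /dirichlet_one eqxx mul1r.
- by move=> _ -> /=; rewrite pvec_mul1.
move=> [a b] /= [abn ne1]; rewrite /dirichlet_one.
have [a1|] := eqVneq; last by rewrite mul0r.
by case: ne1; rewrite -abn a1 pvec_mul1.
Qed.

Lemma dirichlet_mulDl : left_distributive dirichlet_mul +%R.
Proof.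
move=> f g h; apply/funext => n; have [s ns] := covers_ex n.
rewrite [RHS]/GRing.add /= !(dirichlet_mulE _ _ ns) -big_split /=.
apply: eq_bigr => a _; rewrite -big_split /=.
by apply: eq_bigr => b _; rewrite -mulrDl.
Qed.

Lemma dirichlet_one_neq0 : dirichlet_one != 0.
Proof.
apply/eqP => /(congr1 (fun f => f (pvec1 k))) /eqP.
by rewrite /dirichlet_one eqxx oner_eq0.
Qed.

HB.instance Definition _ := GRing.Zmodule_isComNzRing.Build (Omega R k)
  dirichlet_mulA dirichlet_mulC dirichlet_mul1 dirichlet_mulDl
  dirichlet_one_neq0.

End Dirichlet.

(* Main.v *)
(** The monoid of [k]-vectors of positive integers under the componentwise
    product is free commutative, with one generator per pair (coordinate, prime).
    For [k > 0] there are countably infinitely many such pairs, so a bijection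
    between the pairs for [k] and those for [l] extends to an isomorphism of
    monoids. The Dirichlet product depends only on the monoid structure of the
    index set, hence composition with this isomorphism is a ring isomorphism. *)

From HB Require Import structures.
Require Import Defs.
From mathcomp Require Import all_boot all_order all_algebra.
From mathcomp Require Import reals.
From mathcomp Require Import mathcomp_extra boolp classical_sets functions
  cardinality fsbigop finmap.

Set Implicit Arguments.
Unset Strict Implicit.
Unset Printing Implicit Defensive.

Local Open Scope classical_set_scope.

(** Euclid: a prime above every second component of a finite set, placed at coordinate 0, gives a
    pair outside it. *)
Lemma infinite_prime_coords k : (0 < k)%N ->
  infinite_set [set x : 'I_k * nat | prime x.2].
Proof.
move=> k0 finA; pose i0 := Ordinal k0.
have [p pmax p_prime] :=
  prime_above (\max_(x <- fset_set [set x : 'I_k * nat | prime x.2]) x.2).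
have: (i0, p) \in fset_set [set x : 'I_k * nat | prime x.2].
  by rewrite in_fset_set //; apply: mem_set.
move=> pA; have := leq_bigmax_seq (P := xpredT) (F := fun x => x.2) _ pA isT.
by rewrite leqNgt pmax.
Qed.

(** Each set of prime pairs is countably infinite, so both are enumerated by [nat] and the
    enumerations are composed. The maps are total, but inverse to each other only on prime pairs. *)
Lemma prime_coords_bij k l : (0 < k)%N -> (0 < l)%N ->
  exists (h : 'I_k * nat -> 'I_l * nat) (h' : 'I_l * nat -> 'I_k * nat),
  [/\ forall x, prime x.2 -> prime (h x).2 /\ h' (h x) = x
    & forall y, prime y.2 -> prime (h' y).2 /\ h (h' y) = y].
Proof.
have enum n : (0 < n)%N -> exists (f : 'I_n * nat -> nat) (g : nat -> 'I_n * nat),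
    (forall x, prime x.2 -> g (f x) = x) /\ forall m, prime (g m).2 /\ f (g m) = m.
  move=> n0; have [f [_ finj fsurj]] := card_set_bijP
    (eq_card_nat (countableP _) (infinite_prime_coords n0)).
  have /choice[g gP] m : exists x, prime x.2 /\ f x = m.
    by have [x /= px <-] := fsurj m I; exists x.
  exists f; exists g; split; last exact: gP.
  move=> x px; have [pgx fgx] := gP (f x).
  by apply: finj => //; exact: mem_set.
move=> /enum[f [g [gf fg]]] /enum[f' [g' [gf' fg']]].
exists (g' \o f); exists (g \o f'); split=> x px /=.
- by have [? ->] := fg' (f x); rewrite gf.
- by have [? ->] := fg (f' x); rewrite gf'.
Qed.

(* The completely multiplicative function that agrees with [f] on primes. *)
Definition prime_ext (f : nat -> nat) (n : nat) : nat :=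
  \prod_(p <- primes n) f p ^ logn p n.

(** The added factors have exponent 0. A range independent of [n] lets products for different
    arguments be multiplied termwise. *)
Lemma prime_ext_widen f n N : (0 < n <= N)%N ->
  prime_ext f n = \prod_(0 <= p < N.+1) f p ^ logn p n.
Proof.
move=> /andP[n0 nN]; rewrite (bigID (fun p => p \in primes n)) /=.
rewrite [X in (_ * X)%N]big1 => [|p]; last by rewrite -logn_gt0 lt0n negbK => /eqP ->.
rewrite muln1 -big_filter; apply: perm_big; apply: uniq_perm.
- exact: primes_uniq.
- by rewrite filter_uniq // iota_uniq.
move=> p; rewrite mem_filter mem_index_iota ltnS.
case: (boolP (p \in primes n)) => //=; rewrite mem_primes => /and3P[_ _ pn].
by rewrite (leq_trans _ nN) // dvdn_leq.
Qed.

Lemma prime_extM f m n : (0 < m)%N -> (0 < n)%N ->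
  prime_ext f (m * n) = (prime_ext f m * prime_ext f n)%N.
Proof.
move=> m0 n0; rewrite !(@prime_ext_widen _ _ (m * n)) ?muln_gt0 ?m0 ?n0 ?leqnn
  ?leq_pmulr ?leq_pmull //.
by rewrite -big_split; apply: eq_bigr => p _; rewrite lognM // expnD.
Qed.

Lemma prime_ext1 f : prime_ext f 1 = 1%N.
Proof. by rewrite /prime_ext big_nil. Qed.

Lemma prime_ext_prime f p : prime p -> prime_ext f p = f p.
Proof.
by move=> pp; rewrite /prime_ext primes_prime // big_seq1 logn_prime // eqxx expn1.
Qed.

Lemma prime_ext_gt0 f n : (forall p, prime p -> 0 < f p)%N -> (0 < prime_ext f n)%N.
Proof.
move=> f0; rewrite /prime_ext big_seq prodn_cond_gt0 // => p.
by rewrite mem_primes => /andP[/f0 fp _]; rewrite expn_gt0 fp.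
Qed.

(** Strong induction, splitting off a prime divisor. *)
Lemma eq_on_primes (F G : nat -> nat) :
    F 1%N = G 1%N ->
    (forall m n, 0 < m -> 0 < n -> F (m * n) = F m * F n)%N ->
    (forall m n, 0 < m -> 0 < n -> G (m * n) = G m * G n)%N ->
    (forall p, prime p -> F p = G p) ->
  forall n, (0 < n)%N -> F n = G n.
Proof.
move=> FG1 FM GM FGp; elim/ltn_ind => n IH n0.
have [n1|n1] := leqP n 1; first by have -> : n = 1%N by apply/eqP; rewrite eqn_leq n1.
have [p pp /dvdnP[q def_n]] := pdivP n1; move: n0; rewrite def_n muln_gt0 => /andP[q0 p0].
by rewrite FM // GM // (FGp p) // IH // def_n ltn_Pmulr // prime_gt1.
Qed.

Section CoordinateMap.
Variables (k l : nat) (h : 'I_k * nat -> 'I_l * nat).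
Hypothesis h_prime : forall x, prime x.2 -> prime (h x).2.

(* [prime_ext (coord_fun i j) n] is the contribution to coordinate [j] of the
   image of the vector with entry [n] at [i] and 1 elsewhere. *)
Definition coord_fun (i : 'I_k) (j : 'I_l) (p : nat) : nat :=
  if (h (i, p)).1 == j then (h (i, p)).2 else 1%N.

Lemma coord_fun_gt0 i j p : prime p -> (0 < coord_fun i j p)%N.
Proof.
move=> pp; rewrite /coord_fun; case: ifP => // _.
by apply: prime_gt0; exact: (h_prime (x := (i, p))) pp.
Qed.

Lemma pvec_map_gt0 (v : pvec k) j :
  (0 < \prod_i prime_ext (coord_fun i j) (val (v i)))%N.
Proof. by rewrite prodn_gt0 // => i; apply: prime_ext_gt0 => p; exact: coord_fun_gt0. Qed.

(** The monoid morphism that sends the generator [(i, p)] to the generator [h (i, p)]. *)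
Definition pvec_map (v : pvec k) : pvec l :=
  [ffun j => exist (fun n => (0 < n)%N) _ (pvec_map_gt0 v j)].

Lemma pvec_mapM v w : pvec_map (pvec_mul v w) = pvec_mul (pvec_map v) (pvec_map w).
Proof.
apply/ffunP => j; apply: val_inj; rewrite !ffunE /= -big_split /=.
by apply: eq_bigr => i _; rewrite ffunE prime_extM //; exact: valP.
Qed.

Lemma pvec_map1 : pvec_map (pvec1 k) = pvec1 l.
Proof.
apply/ffunP => j; apply: val_inj; rewrite !ffunE /=.
by apply: big1 => i _; rewrite ffunE prime_ext1.
Qed.

End CoordinateMap.

Lemma prime_ext_prod f (I : Type) (r : seq I) (F : I -> nat) :
    (forall i, 0 < F i)%N ->
  prime_ext f (\prod_(i <- r) F i) = \prod_(i <- r) prime_ext f (F i).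
Proof.
move=> F0; elim: r => [|i r IH]; first by rewrite !big_nil prime_ext1.
by rewrite !big_cons prime_extM ?IH // prodn_gt0.
Qed.

Lemma pvec_mapK k l (h : 'I_k * nat -> 'I_l * nat) (h' : 'I_l * nat -> 'I_k * nat)
    (hp : forall x, prime x.2 -> prime (h x).2)
    (hp' : forall y, prime y.2 -> prime (h' y).2) :
    (forall x, prime x.2 -> h' (h x) = x) ->
  cancel (pvec_map hp) (pvec_map hp').
Proof.
move=> hK v; apply/ffunP => a; apply: val_inj; rewrite ffunE /=.
have ext_gt0 i j n : (0 < prime_ext (coord_fun h i j) n)%N.
  by apply: prime_ext_gt0 => p; exact: coord_fun_gt0.
under eq_bigr => j _ do rewrite ffunE /= prime_ext_prod //.
rewrite exchange_big /=.
(* [F i n] is what an entry [n] at [i] contributes to coordinate [a] after the round trip. It is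
   multiplicative in [n], so primes suffice to determine it. *)
pose F i n := \prod_j prime_ext (coord_fun h' j a) (prime_ext (coord_fun h i j) n).
have comp i n : (0 < n)%N -> F i n = if i == a then n else 1%N.
  move: n; apply: (eq_on_primes (F := F i)
    (G := fun n => if i == a then n else 1%N)); rewrite /F.
  - by rewrite if_same; apply: big1 => j _; rewrite !prime_ext1.
  - move=> m n m0 n0; rewrite -big_split; apply: eq_bigr => j _.
    by rewrite prime_extM // prime_extM.
  - by move=> m n _ _; case: ifP; rewrite ?muln1.
  (* The prime [p] at [i] is sent to the single coordinate [(h (i, p)).1]; every other factor is
     1. *)
  move=> p pp; rewrite (bigD1 (h (i, p)).1) //= big1 => [|j ne].
    rewrite muln1 (prime_ext_prime _ pp) {2}/coord_fun eqxx prime_ext_prime.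
      by rewrite /coord_fun -surjective_pairing hK.
    exact: (hp (i, p)).
  by rewrite (prime_ext_prime _ pp) /coord_fun eq_sym (negbTE ne) prime_ext1.
rewrite (eq_bigr (fun i => if i == a then val (v i) else 1%N)) => [|i _].
  by rewrite -big_mkcond big_pred1_eq.
exact/comp/(valP (v i)).
Qed.

Import GRing.Theory.

(** Applying [s] to both factors is a bijection from the factorizations of [n] onto those of [s n],
    so the sum is reindexed. *)
Lemma dirichlet_mul_comp (R : realType) k l (s : pvec l -> pvec k)
    (s' : pvec k -> pvec l) (f g : Omega R k) :
    cancel s s' -> cancel s' s ->
    (forall v w, s (pvec_mul v w) = pvec_mul (s v) (s w)) ->
  dirichlet_mul f g \o s =
  dirichlet_mul (f \o s : Omega R l) (g \o s : Omega R l).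
Proof.
move=> sK s'K sM; apply/funext => n /=; rewrite /dirichlet_mul.
rewrite (@reindex_fsbig _ _ _ _ _ (fun ab => (s ab.1, s ab.2))
  [set ab | pvec_mul ab.1 ab.2 = n]) //.
split.
- by move=> [a b] /= <-; rewrite sM.
- by move=> [a b] [c d] _ _ /= [/(can_inj sK) -> /(can_inj sK) ->].
move=> [a b] /= abn; exists (s' a, s' b) => /=; last by rewrite !s'K.
by apply: (can_inj sK); rewrite sM !s'K.
Qed.

Theorem theorem2p7 (R : realType) (k l : nat) (hk : (0 < k)%N) (hl : (0 < l)%N) :
  exists phi : {rmorphism Omega R k -> Omega R l}, bijective phi.
Proof.
(* Composition is contravariant: a map from [Omega R k] to [Omega R l] needs [s] from [pvec l] to
   [pvec k]. *)
have [h [h' [hP hP']]] := prime_coords_bij hl hk.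
have hp x : prime x.2 -> prime (h x).2 by case/hP.
have hp' y : prime y.2 -> prime (h' y).2 by case/hP'.
pose s := pvec_map hp; pose s' := pvec_map hp'.
have sK : cancel s s' by apply: pvec_mapK => x /hP[].
have s'K : cancel s' s by apply: pvec_mapK => x /hP'[].
pose phi (f : Omega R k) : Omega R l := f \o s.
have phiB : zmod_morphism phi by [].
have phiM : monoid_morphism phi.
  split; last by move=> f g; exact: dirichlet_mul_comp sK s'K (pvec_mapM hp).
  (* The unit is the indicator of [pvec1], which the injective [s] preserves. *)
  apply/funext => n; rewrite /phi /= /GRing.one /= /dirichlet_one.
  by rewrite -(pvec_map1 hp) (can_eq sK).
pose phiZ := GRing.isZmodMorphism.Build _ _ phi phiB.
pose phiX := GRing.isMonoidMorphism.Build _ _ phi phiM.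
pose phiR : {rmorphism Omega R k -> Omega R l} := HB.pack phi phiZ phiX.
exists phiR; exists (fun g : Omega R l => (g \o s' : Omega R k)) => f.
- by apply/funext => n; rewrite /= /phi /= s'K.
- by apply/funext => n; rewrite /= /phi /= sK.
Qed.
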